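(* There exists a directed set $\mathcal A$, which is not a cardinal number, with $\operatorname{card}(\mathcal A)=\operatorname{cov}(\mathcal N)$, such that $\mathcal{AN}_{\mathcal A}$ is strongly $2^{\mathfrak c}$-algebrable in $\left(\mathbb R^{\mathbb R}\right)^{\mathcal A}$.
   Context: A directed set is a nonempty set $\mathcal A$ with a reflexive transitive relation $\le$ in which any two elements have an upper bound; $x_A\to x$ if for each neighbourhood $U$ of $x$ there is $A_0$ with $x_A\in U$ for $A\ge A_0$. $\left(\mathbb R^{\mathbb R}\right)^{\mathcal A}$ is the commutative real algebra of nets of functions $\mathbb R\to\mathbb R$ with indexwise operations. $\mathcal N$ denotes the Lebesgue null sets; $\operatorname{cov}(\mathcal N)$ is the least cardinality of a family of null sets covering $[0,1]$ (equivalently $\mathbb R$); $\mathfrak c=2^{\aleph_0}$. $\mathcal{AN}_{\mathcal A}$: nets of Lebesgue measurable functions $f_A:\mathbb R\to\mathbb R$ that converge pointwise a.e. to a non-Lebesgue-measurable function. A subset $S$ of a commutative algebra is strongly $\kappa$-algebrable if there is a set $X$ of $\kappa$ algebraically independent elements such that every nonzero element of the (non-unital) algebra generated by $X$ belongs to $S$. *)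

(* Defs.v *)
From HB Require Import structures.
From mathcomp Require Import all_boot all_algebra.
From mathcomp Require Import mpoly.
From mathcomp Require Import all_classical all_reals all_analysis.
Import numFieldNormedType.Exports.

Set Implicit Arguments.
Unset Strict Implicit.
Unset Printing Implicit Defensive.

Local Open Scope classical_set_scope.
Local Open Scope ring_scope.

Definition directed_set (A : Type) (le : A -> A -> Prop) : Prop :=
  inhabited A /\
  (forall a, le a a) /\
  (forall a b c, le a b -> le b c -> le a c) /\
  (forall a b, exists c, le a c /\ le b c).

(* (A, le) "is a cardinal number": it is (order-isomorphic to) an initial
   ordinal, i.e. a well-order every proper initial segment of which has
   cardinality strictly smaller than A. *)
Definition is_cardinal_order (A : Type) (le : A -> A -> Prop) : Prop :=
  (forall a b, le a b -> le b a -> a = b) /\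
  (forall a b, le a b \/ le b a) /\
  well_founded (fun a b => le a b /\ a <> b) /\
  (forall x : A, ~ (([set: A] #<= [set y | le y x /\ y <> x])%card)).

Definition net_cvg (A : Type) (le : A -> A -> Prop) (T : topologicalType)
  (u : A -> T) (l : T) : Prop :=
  forall U, nbhs l U -> exists a0, forall a, le a0 a -> U (u a).

Definition null_set (R : realType) (N : set R) : Prop :=
  (@lebesgue_measure R).-negligible N.

(* The real line equipped with the Lebesgue (= completed) sigma-algebra,
   i.e. the domain of the library's completed Lebesgue measure. *)
Notation LebR R := (caratheodory_type (R:=R) (wlength (R:=R) idfun)^*%mu).

Definition lebesgue_measurable_fun (R : realType) (f : R -> R) : Prop :=
  measurable_fun (setT : set (LebR R)) (f : LebR R -> R).

Definition card_is_covN (R : realType) (T : Type) : Prop :=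
  (exists F : set (set R), (forall E, F E -> null_set E) /\
     \bigcup_(E in F) E = setT /\ (F #= [set: T])%card) /\
  (forall G : set (set R), (forall E, G E -> null_set E) ->
     \bigcup_(E in G) E = setT -> ([set: T] #<= G)%card).

Definition AN (R : realType) (A : Type) (le : A -> A -> Prop)
  (F : A -> R -> R) : Prop :=
  (forall a, lebesgue_measurable_fun (F a)) /\
  exists g : R -> R, ~ lebesgue_measurable_fun g /\
    exists N : set R, null_set N /\
      forall x, ~ N x -> net_cvg le (fun a => F a x) (g x).

Definition peval (R : realType) (A : Type) (n : nat) (P : mpoly.mpoly n R)
  (f : 'I_n -> A -> R -> R) : A -> R -> R :=
  fun a x => mpoly.meval (fun i => f i a x) P.

(* Algebraic independence in the (non-unital) algebra (R^R)^A: no nonzero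
   polynomial without constant term vanishes at distinct elements of X. *)
Definition alg_independent (R : realType) (A : Type) (X : set (A -> R -> R))
  : Prop :=
  forall (n : nat) (f : 'I_n -> A -> R -> R) (P : mpoly.mpoly n R),
    injective f -> (forall i, X (f i)) ->
    P != 0 -> mpoly.mcoeff (@mpoly.mnm0 n) P = 0 ->
    peval P f <> 0.

Definition strongly_algebrable (R : realType) (A : Type)
  (S : set (A -> R -> R)) (K : Type) : Prop :=
  exists X : set (A -> R -> R),
    (X #= [set: K])%card /\ alg_independent X /\
    (forall (n : nat) (f : 'I_n -> A -> R -> R) (P : mpoly.mpoly n R),
       (forall i, X (f i)) -> mpoly.mcoeff (@mpoly.mnm0 n) P = 0 ->
       peval P f <> 0 -> S (peval P f)).

(* Main.v *)
Require Import Defs.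
From HB Require Import structures.
From mathcomp Require Import all_boot all_order all_algebra.
From mathcomp Require Import mpoly.
From mathcomp Require Import all_classical all_reals all_analysis.
From mathcomp Require Import measurable_realfun lra.
From mathcomp Require wochoice.

(* Take a null cover [G] of the line of least cardinality and let the directed
   set be the finite sequences over [G] ordered by inclusion; it has the
   cardinality of [G].  Cutting a function [g] down to the union of a finite
   part of [G] gives a net of almost everywhere zero, hence measurable,
   functions which is eventually equal to [g] at each point, and this operation
   commutes with polynomials without constant term.  It therefore suffices to
   find [2^c] functions all of whose nonzero polynomial combinations are
   nonmeasurable.  Split the line into [c] Bernstein sets [B_d] (each meeting
   every closed set of positive measure), indexed so as to carry an independent
   family of [2^c] real functions [h_A] of [d] all vanishing at some [d0], and
   let [g_A] be [h_A d] on [B_d].  A nonzero combination of the [g_A] vanishes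
   on [B_d0] and is nonzero on some other [B_d1], so its zero set is not
   measurable. *)

Set Implicit Arguments.
Unset Strict Implicit.
Unset Printing Implicit Defensive.
Import Order.TTheory GRing.Theory Num.Theory.
Import numFieldNormedType.Exports.
Local Open Scope classical_set_scope.

(** * Cardinal arithmetic *)

Definition embeds (X Y : Type) : Prop := exists f : X -> Y, injective f.

Lemma embeds_trans (X Y Z : Type) : embeds X Y -> embeds Y Z -> embeds X Z.
Proof. by move=> [f fi] [g gi]; exists (g \o f); exact: inj_comp. Qed.

Lemma card_le_embeds (T U : Type) (A : set T) (B : set U) :
  (A #<= B)%card <-> embeds A B.
Proof.
split=> [/card_leP[f]|[f fi]].
  by exists f => x y fxy; apply: (@inj _ _ [set: A] f); rewrite ?in_setT.
apply/card_leP/injfunPex; exists f => // x y _ _; exact: fi.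
Qed.

Lemma embeds_setT (T : Type) : embeds [set: T] T /\ embeds T [set: T].
Proof.
split; first by exists val; exact: val_inj.
by exists (fun x => exist _ x (mem_set I)) => x y [].
Qed.

(* A maximal set of choice functions whose evaluations are all injective must
   be onto some [X i], for otherwise a missed value of every [X i] would give
   one more choice function. *)
Lemma embeds_minimum (I : Type) (X : I -> Type) : inhabited I ->
  exists i, forall j, embeds (X i) (X j).
Proof.
move=> [i0].
pose P (S : set (forall i, X i)) :=
  forall i f g, S f -> S g -> f i = g i -> f = g.
have [|S [PS maxS]] := @Zorn_bigcup _ P.
  move=> F FP Ftot i f g [A FA Af] [B FB Bg] fg.
  by have [AB|BA] := Ftot _ _ FA FB; [apply: (FP _ FB i) => //; exact: AB
    | apply: (FP _ FA i) => //; exact: BA].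
have [[i onto]|nonto] := pselect (exists i, forall x, exists2 f, S f & f i = x).
  exists i => j; have /choice[c cP] : forall x, exists f, S f /\ f i = x.
    by move=> x; have [f] := onto x; exists f.
  exists (fun x => c x j) => x y cxy.
  have [Sx <-] := cP x; have [Sy <-] := cP y.
  by rewrite (PS j _ _ Sx Sy cxy).
have miss i : exists x, forall f, S f -> f i <> x.
  apply/not_existsP => h; apply: nonto; exists i => x.
  by apply: contrapT => hx; apply: (h x) => f Sf fx; apply: hx; exists f.
pose g i := projT1 (cid (miss i)).
have gP i f : S f -> f i <> g i by move: f; exact: (projT2 (cid (miss i))).
exfalso; apply: (maxS (S `|` [set g])).
  split; first by move=> x Sx; left.
  by move=> /(_ g (or_intror erefl)) /(gP i0).
move=> i f h [Sf|->] [Sh|->] //; first exact: PS.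
- by move/(gP i _ Sf).
- by move/esym/(gP i _ Sh).
Qed.

Lemma embeds_total (X Y : Type) : embeds X Y \/ embeds Y X.
Proof.
have [[] h] := @embeds_minimum bool (fun b => if b then X else Y) (inhabits true).
  by left; exact: (h false).
by right; exact: (h true).
Qed.

(** * Squares and finite sequences over an infinite type *)

Section square.
Variables (T : Type) (e : nat -> T).
Hypothesis e_inj : injective e.

(** The operation is total on [T] to avoid dependent types. Only its values on the carrier matter,
    so extension ([leq_good]) is a mere preorder. *)
Let good (p : set T * (T -> T -> T)) :=
  [/\ range e `<=` p.1, (forall a b, p.1 a -> p.1 b -> p.1 (p.2 a b)) &
   forall a b a' b', p.1 a -> p.1 b -> p.1 a' -> p.1 b' ->
     p.2 a b = p.2 a' b' -> a = a' /\ b = b'].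

Let leq_good (p q : {p | good p}) : bool :=
  `[< (sval p).1 `<=` (sval q).1 /\ forall a b, (sval p).1 a -> (sval p).1 b ->
        (sval p).2 a b = (sval q).2 a b >].

Let good_base : exists p, good p.
Proof.
have [d de] : exists d : T -> nat, cancel e d.
  have /choice[d dP] : forall x, exists n, forall m, e m = x -> n = m.
    move=> x; have [[n <-]|h] := pselect (exists n, e n = x).
      by exists n => m /e_inj.
    by exists 0%N => m em; exfalso; apply: h; exists m.
  by exists d => n; exact: dP.
exists (range e, fun a b => e (choice.pickle (d a, d b))); split => //=.
  by move=> a b _ _; eexists.
move=> _ _ _ _ [a _ <-] [b _ <-] [a' _ <-] [b' _ <-] /e_inj.
by rewrite !de => /(pcan_inj choice.pickleK)[-> ->].
Qed.

Let exists_maximal_good : exists p, good p /\ forall q, good q ->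
  p.1 `<=` q.1 ->
  (forall a b, p.1 a -> p.1 b -> p.2 a b = q.2 a b) -> q.1 `<=` p.1.
Proof.
have [p0 gp0] := good_base.
have [|||p pmax] := @ZL_preorder _ (exist _ p0 gp0) leq_good.
- by move=> p; apply/asboolP; split.
- move=> p q r /asboolP[pq epq] /asboolP[qr eqr]; apply/asboolP; split.
    by move=> x /pq/qr.
  by move=> a b pa pb; rewrite epq// eqr//; exact: pq.
- move=> A Atot.
  have [[q0 Aq0]|A0] := pselect (exists q, A q); last first.
    by exists (exist _ p0 gp0) => q Aq; exfalso; apply: A0; exists q.
  pose S := \bigcup_(q in A) (sval q).1.
  have common q r : A q -> A r -> exists s, [/\ A s, leq_good q s & leq_good r s].
    move=> Aq Ar; have [qr|rq] := Atot _ _ Aq Ar.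
      by exists r; split => //; apply/asboolP; split.
    by exists q; split => //; apply/asboolP; split.
  (* Members of the chain agree wherever two of them apply, so the union carries one operation;
     where none applies, [a] is a dummy value. *)
  have mP a b : exists c, forall q, A q -> (sval q).1 a -> (sval q).1 b ->
      (sval q).2 a b = c.
    have [[q [Aq qa qb]]|h] := pselect (exists q, [/\ A q, (sval q).1 a & (sval q).1 b]).
      exists ((sval q).2 a b) => r Ar ra rb.
      have [s [As /asboolP[_ qs] /asboolP[_ rs]]] := common _ _ Aq Ar.
      by rewrite qs// rs.
    by exists a => q Aq qa qb; exfalso; apply: h; exists q.
  pose m a b := projT1 (cid (mP a b)).
  have mE q a b : A q -> (sval q).1 a -> (sval q).1 b -> (sval q).2 a b = m a b.
    by move: q; exact: (projT2 (cid (mP a b))).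
  have two a b : S a -> S b -> exists q, [/\ A q, (sval q).1 a & (sval q).1 b].
    move=> [q Aq qa] [r Ar rb].
    have [s [As /asboolP[qs _] /asboolP[rs _]]] := common _ _ Aq Ar.
    by exists s; split; [|exact: qs|exact: rs].
  have gS : good (S, m).
    split=> /= [x ex|a b Sa Sb|a b a' b' Sa Sb Sa' Sb'].
    - by exists q0 => //; have [+ _ _] := svalP q0; exact.
    - have [q [Aq qa qb]] := two _ _ Sa Sb.
      by exists q => //; rewrite -(mE q)//; have [_ + _] := svalP q; exact.
    - have [q [Aq qa qb]] := two _ _ Sa Sb.
      have [r [Ar ra rb]] := two _ _ Sa' Sb'.
      have [s [As /asboolP[qs _] /asboolP[rs _]]] := common _ _ Aq Ar.
      rewrite -!(mE s)//; try by [exact: qs|exact: rs].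
      by have [_ _ + ] := svalP s; apply; by [exact: qs|exact: rs].
  exists (exist _ (S, m) gS) => q Aq; apply/asboolP; split => /=.
    by move=> x qx; exists q.
  by move=> a b; exact: mE.
- exists (sval p); split; first exact: svalP.
  move=> q gq pq epq.
  by have /asboolP[] : leq_good (exist _ q gq) p by apply: pmax; apply/asboolP.
Qed.

(** Take a maximal pairing [m] on [S]. If [S] embedded into its complement, [m] would extend to [S]
    together with a disjoint copy of it. So the complement embeds into [S], and a one-bit tag packs
    [T] into [S]. *)
Lemma embeds_square : embeds (T * T) T.
Proof.
have [[S m] [[/= eS Sm m_inj] Smax]] := exists_maximal_good.
have Se n : S (e n) by apply: eS; exists n.
have [[h hi]|[h hi]] := embeds_total (~` S) S; last first.
  exfalso; have hS (x : S) : ~ S (val (h x)).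
    by have := svalP (h x); rewrite in_setE.
  pose k x (Sx : S x) := val (h (exist _ x (mem_set Sx))).
  (* [i] folds the copy of [S] back onto [S]; outside both halves [e 0] is a dummy value. *)
  have /choice[i iP] : forall x, exists y, S y /\ (S x -> y = x) /\
      (forall (z : S), x = val (h z) -> y = val z).
    move=> x; have [Sx|nSx] := pselect (S x).
      by exists x; split => //; split => // z xz; case: (hS z); rewrite -xz.
    have [[z ->]|nz] := pselect (exists z, x = val (h z)).
      exists (val z); split; first by have := svalP z; rewrite in_setE.
      by split=> [/hS//|w /val_inj/hi ->].
    exists (e 0); split => //; split => // z xz; exfalso; apply: nz.
    by exists z.
  have iS x : S (i x) by case: (iP x).
  have iid x : S x -> i x = x by case: (iP x) => _ [].
  have ih z : i (val (h z)) = val z by case: (iP (val (h z))) => _ [_]; exact.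
  pose H x (Sx : S x) : T := val (h (exist _ x (mem_set Sx))).
  pose S1 := S `|` range (val \o h).
  have iinj x y : S1 x -> S1 y -> (S x <-> S y) -> i x = i y -> x = y.
    move=> [Sx|[z _ <-]] [Sy|[w _ <-]] /= xy.
    - by rewrite !iid.
    - by case: (hS w); apply/xy.
    - by case: (hS z); apply/xy.
    - by rewrite !ih => /val_inj ->.
  (* [i] is injective only on each half, so the tag records in which half each argument lies. *)
  pose tag a b := e (`[< S a >] + `[< S b >].*2).
  have tagS a b : S (tag a b) by exact: Se.
  have tag_inj a b a' b' : tag a b = tag a' b' -> (S a <-> S a') /\ (S b <-> S b').
    move/e_inj; do 4 (case: asboolP => ?); by move=> // _; split; split.
  have codeS a b : S (m (tag a b) (m (i a) (i b))) by apply: (Sm) => //; apply: Sm.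
  (* New pairs take their values in the fresh copy, away from those of [m] on [S]. *)
  pose M a b := if `[< S a /\ S b >] then m a b else H _ (codeS a b).
  have ME a b : ~ (S a /\ S b) -> M a b = H _ (codeS a b).
    by rewrite /M; case: asboolP.
  have ME' a b : S a -> S b -> M a b = m a b.
    by move=> Sa Sb; rewrite /M; case: asboolP => // -[].
  have HnS x Sx : ~ S (@H x Sx) by exact: hS.
  have HS1 x Sx : S1 (@H x Sx) by right; eexists.
  suff /(_ _ (HS1 _ (Se 0))) : S1 `<=` S by exact: HnS.
  apply: (Smax (S1, M)).
  - split => /=.
    + by move=> x ex; left; exact: eS.
    + move=> a b _ _; have [[Sa Sb]|nS] := pselect (S a /\ S b).
        by rewrite ME'//; left; apply: Sm.
      by rewrite ME.
    + move=> a b a' b' Sa Sb Sa' Sb'.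
      have [[S0a S0b]|nS] := pselect (S a /\ S b);
      have [[S0a' S0b']|nS'] := pselect (S a' /\ S b').
      * by rewrite !ME'//; exact: m_inj.
      * by rewrite ME'// ME// => E; case: (@HnS _ (codeS a' b')); rewrite -E; apply: Sm.
      * by rewrite (ME' a')// ME// => E; case: (@HnS _ (codeS a b)); rewrite E; apply: Sm.
      * rewrite !ME// /H => /val_inj/hi[] /m_inj[]//; try by apply: Sm.
        move=> /tag_inj[aa bb] /m_inj[]// ia ib.
        by split; apply: iinj.
  - by move=> x Sx; left.
  - by move=> a b Sa Sb /=; rewrite ME'.
have [c ci] : embeds T S.
  have tS a b (Sa : S a) (Sb : S b) : m a b \in S by apply/mem_set/Sm.
  pose r x := if pselect (S x) is left Sx then x
              else if pselect ((~` S) x) is left nSx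
                   then val (h (exist _ x (mem_set nSx))) else x.
  have rS x : S (r x).
    rewrite /r; case: pselect => // nSx; case: pselect => // nSx'.
    by have := svalP (h (exist _ x (mem_set nSx'))); rewrite in_setE.
  exists (fun x => exist _ (m (e `[< S x >]) (r x)) (tS _ _ (Se _) (rS x))).
  move=> x y [] /m_inj[]// /e_inj; rewrite /r.
  case: asboolP; case: asboolP => //= Sx Sy _.
    by do 2 case: pselect => //.
  by do 4 case: pselect => //; move=> ? ? ? ? /val_inj/hi[].
exists (fun p => m (val (c p.1)) (val (c p.2))).
have cS x : S (sval (c x)) by have := svalP (c x); rewrite in_setE.
by move=> [a b] [a' b'] /= /m_inj[]// /val_inj/ci -> /val_inj/ci ->.
Qed.

Lemma embeds_seq : embeds (seq T) T.
Proof.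
have [m mi] := embeds_square.
(* The length has to be stored too: [m] may take the value [e 0], so the fold alone does not mark
   its end. *)
pose c s := foldr (fun x y => m (x, y)) (e 0) s.
exists (fun s => m (e (size s), c s)) => s t /mi[/e_inj].
elim: s t => [|x s IH] [|y t] //= [st] /mi[-> /(IH _ st) ->//].
Qed.

End square.

(** * Well-orders and distinct representatives *)

Lemma sval_inj (T : Type) (P : T -> Prop) : injective (@sval T P).
Proof. by move=> [x px] [y py] /= xy; exact: eq_exist. Qed.

(* Pulling a well-order of [I] back along an embedding into its shortest
   initial segment of full cardinality makes all initial segments smaller. *)
Lemma embeds_initial_order (I : Type) : exists lt : I -> I -> Prop,
  [/\ well_founded lt, (forall i j, lt i j \/ i = j \/ lt j i) &
   forall i, ~ embeds I {j | lt j i}].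
Proof.
have [R Rwo] := wochoice.well_ordering_principle {classic I}.
have Rmin (A : set I) : A !=set0 -> exists x, A x /\ forall y, A y -> R x y.
  move=> [x Ax]; have [|z [[zA zmin] _]] := Rwo (mem A).
    by exists x; apply/mem_set.
  exists z; split; first by exact: set_mem.
  by move=> y Ay; apply: zmin; exact/mem_set.
have Rtot x y : R x y \/ R y x.
  have [|z [[->|->]]] := Rmin [set x; y]; first by exists x; left.
    by move/(_ y (or_intror erefl)); left.
  by move/(_ x (or_introl erefl)); right.
have Ranti x y : R x y -> R y x -> x = y.
  move=> xy yx.
  have xx : R x x by case: (Rtot x x).
  have yy : R y y by case: (Rtot y y).
  have [|z [_ zu]] := Rwo (mem [set x; y]).
    by exists x; apply/mem_set; left.
  rewrite -(zu x) ?(zu y)//; split; try (by apply/mem_set; [left|right]).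
  - by apply/mem_set; right.
  - by move=> w /set_mem[]->.
  - by apply/mem_set; left.
  - by move=> w /set_mem[]->.
pose lt x y := ~ R y x.
have ltwf : well_founded lt.
  move=> x; apply: contrapT => nx.
  have [|y [ny ymin]] := Rmin [set x | ~ Acc lt x]; first by exists x.
  apply: ny; constructor => z zy; apply: contrapT => nz.
  exact: (zy (ymin _ nz)).
have lttri x y : lt x y \/ x = y \/ lt y x.
  rewrite /lt; have [xy|nxy] := pselect (R x y); last by right; right.
  have [yx|nyx] := pselect (R y x); last by left.
  by right; left; exact: Ranti.
have [[i0 hi0]|h] := pselect (exists i, embeds I {j | lt j i}); last first.
  by exists lt; split => // i hi; apply: h; exists i.
have [|i [[f fi] imin]] := Rmin [set i | embeds I {j | lt j i}].
  by exists i0.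
exists (fun x y => lt (sval (f x)) (sval (f y))); split.
- move=> x; move: {2}(sval (f x)) (erefl (sval (f x))) => z.
  elim/(well_founded_ind ltwf): z x => z IH x xz; constructor => y.
  by rewrite xz => yx; apply: (IH _ yx).
- move=> x y; have [|[|]] := lttri (sval (f x)) (sval (f y)); auto.
  by move=> fxy; right; left; apply: fi; exact: sval_inj.
(* An embedding of [I] below [x] would give one below [f x], which precedes the least such point
   [i]. *)
- move=> x [g gi]; have ltx := svalP (f x); rewrite /= /lt in ltx.
  apply: (ltx); apply: imin.
  exists (fun y => exist _ (sval (f (sval (g y)))) (svalP (g y))).
  by move=> y z [] /sval_inj/fi/sval_inj/gi.
Qed.

(** Recursion along the order of [embeds_initial_order]: the points used before stage [i] are too
    few to exhaust [K i]. *)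
Lemma distinct_representatives (I U : Type) (K : I -> set U) :
  (forall i, embeds I (K i)) ->
  exists psi : I -> U, injective psi /\ forall i, K i (psi i).
Proof.
move=> IK; have [lt [ltwf lttri ltsmall]] := embeds_initial_order I.
have free i (g : {j | lt j i} -> U) : exists x, K i x /\ forall j, g j <> x.
  apply: contrapT => h.
  have /choice[c cP] : forall x : K i, exists j, g j = val x.
    move=> x; apply: contrapT => nx; apply: h; exists (val x).
    split; first by have := svalP x; rewrite in_setE.
    by move=> j gj; apply: nx; exists j.
  apply: (ltsmall i); apply: embeds_trans (IK i) _; exists c => x y cxy.
  by apply: val_inj; rewrite -!cP cxy.
pose step i (g : forall j, lt j i -> U) :=
  projT1 (cid (free i (fun j => g (sval j) (svalP j)))).
pose psi := Fix ltwf (fun=> U) step.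
have psiE i : psi i = step i (fun j _ => psi j).
  rewrite /psi Fix_eq// => j f g fg; congr (step j).
  by apply: functional_extensionality_dep => k; apply/funext => ?; exact: fg.
have psiP i : K i (psi i) /\ forall j, lt j i -> psi j <> psi i.
  rewrite (psiE i) /step; case: cid => x [Kx nx] /=; split => // j ji.
  exact: (nx (exist _ j ji)).
exists psi; split => [i j ij|i]; last by case: (psiP i).
have [h|[//|h]] := lttri i j.
- by have [_ /(_ i h)] := psiP j.
- by have [_ /(_ j h)] := psiP i; rewrite ij.
Qed.

Local Open Scope ring_scope.

(** * Coding by sets of natural numbers *)

Lemma embeds_set (X Y : Type) : embeds X Y -> embeds (set X) (set Y).
Proof.
move=> [f fi]; exists (fun A => f @` A) => A B AB; apply/seteqP; split => x Ax.
  by have : (f @` B) (f x) by [rewrite -AB; exists x]; move=> [y By /fi <-].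
by have : (f @` A) (f x) by [rewrite AB; exists x]; move=> [y Ay /fi <-].
Qed.

Lemma embeds_set_count (C : countType) : embeds (set C) (set nat).
Proof. by apply: embeds_set; exists choice.pickle; exact: (pcan_inj choice.pickleK). Qed.

Lemma embeds_prod_set_nat (X Y : Type) :
  embeds X (set nat) -> embeds Y (set nat) -> embeds (X * Y) (set nat).
Proof.
move=> [f fi] [g gi]; apply: embeds_trans (embeds_set_count (nat + nat)%type).
exists (fun p => [set z | match z with inl n => f p.1 n | inr n => g p.2 n end]).
move=> [x y] [x' y'] /= /seteqP[h1 h2]; congr (_, _).
  by apply: fi; apply/seteqP; split => n fn; [exact: (h1 (inl n))|exact: (h2 (inl n))].
by apply: gi; apply/seteqP; split => n fn; [exact: (h1 (inr n))|exact: (h2 (inr n))].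
Qed.

Lemma embeds_fun_set_nat (C : countType) (X : Type) :
  embeds X (set nat) -> embeds (C -> X) (set nat).
Proof.
move=> [f fi]; apply: embeds_trans (embeds_set_count (C * nat)%type).
exists (fun g => [set z | f (g z.1) z.2]) => g h /seteqP[h1 h2].
apply/funext => c; apply: fi.
by apply/seteqP; split => n fn; [exact: (h1 (c, n))|exact: (h2 (c, n))].
Qed.

Lemma embeds_nat_set_nat : embeds nat (set nat).
Proof. by exists (fun n => [set n]) => m n /seteqP[/(_ m erefl)]. Qed.

Section real_coding.
Variable R : realType.

Lemma embeds_real_set_nat : embeds R (set nat).
Proof.
apply: embeds_trans (embeds_set_count rat).
exists (fun x => [set q | ratr q < x]) => x y xy.
wlog lt_xy : x y xy / x < y.
  by move=> h; have [/h->//|/h h'|//] := ltgtP x y; rewrite h'.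
have [q] := rat_in_itvoo lt_xy; rewrite in_itv /= => /andP[xq qy].
have : [set q | ratr q < y] q by [].
by rewrite -xy /= ltNge (ltW xq).
Qed.

(** A closed set is recovered from the rational open intervals that miss it. This bounds the number
    of requirements on a Bernstein set by the continuum. *)
Lemma embeds_closed_set_nat : embeds {K : set R | closed K} (set nat).
Proof.
apply: embeds_trans (embeds_set_count (rat * rat)%type).
exists (fun K : {K : set R | closed K} =>
  [set pq | sval K `&` `]ratr pq.1, ratr pq.2[ = set0]) => K L KL.
apply: sval_inj.
have sub (A B : {K : set R | closed K}) : [set pq | sval A `&` `]ratr pq.1, ratr pq.2[ = set0]
    = [set pq | sval B `&` `]ratr pq.1, ratr pq.2[ = set0] -> sval A `<=` sval B.
  move=> AB x Ax; apply: contrapT => nBx.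
  have oB : open (~` sval B) by apply: closed_openC; exact: svalP B.
  have /nbhs_ballP[e /= e0 xeB] : nbhs x (~` sval B) by exact: open_nbhs_nbhs.
  have [p] := @rat_in_itvoo R (x - e) x ltac:(lra).
  rewrite in_itv /= => /andP[ep px].
  have [q] := @rat_in_itvoo R x (x + e) ltac:(lra).
  rewrite in_itv /= => /andP[xq qe].
  have : [set pq | sval B `&` `]ratr pq.1, ratr pq.2[ = set0] (p, q).
    apply/seteqP; split => y //= [By]; rewrite in_itv /= => /andP[py yq].
    by apply: (xeB y) By; rewrite /ball /= ltr_distl; apply/andP; split; lra.
  rewrite -AB /= => /seteqP[/(_ x) + _]; apply; split => //=.
  by rewrite in_itv /= px.
by apply/seteqP; split; apply: sub.
Qed.

(* Ternary expansions with digits 0 and 1 determine their digits. *)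
Lemma embeds_set_nat_real : exists f : set nat -> R,
  injective f /\ forall S, 0 <= f S <= 3 / 2.
Proof.
pose u (S : set nat) n : R := \sum_(k < n) (`[< S k >])%:R * 3^-1 ^+ k.
have uE S n : u S n.+1 = u S n + (if `[< S n >] then 3^-1 ^+ n else 0).
  by rewrite /u big_ord_recr /=; case: asboolP; rewrite ?mul1r ?mul0r.
have tail S n m : (n <= m)%N -> u S m <= u S n + 3 / 2 * (3^-1 ^+ n - 3^-1 ^+ m).
  move=> /subnK <-; elim: (m - n)%N => [|d IH]; first by rewrite add0n; lra.
  rewrite addSn uE exprS.
  have := @exprn_ge0 R (d + n) 3^-1 ltac:(lra).
  by case: asboolP => _; lra.
have incr S n m : (n <= m)%N -> u S n <= u S m.
  move=> /subnK <-; elim: (m - n)%N => [|d IH]; first by rewrite add0n.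
  rewrite addSn uE.
  have := @exprn_ge0 R (d + n) 3^-1 ltac:(lra).
  by case: asboolP => _; lra.
have le32 S m : u S m <= 3 / 2.
  have := tail S 0%N m (leq0n m); rewrite /u big_ord0 expr0 -/(u S m).
  by have := @exprn_ge0 R m 3^-1 ltac:(lra); lra.
pose f S := sup (range (u S)).
have hs S : has_sup (range (u S)).
  by split; [exists (u S 0); exists 0%N|exists (3 / 2) => _ [n _ <-]].
have ge_f S n : u S n <= f S by apply: ub_le_sup; [case: (hs S)|exists n].
have le_f S x : (forall n, u S n <= x) -> f S <= x.
  by move=> h; apply: ge_sup; [case: (hs S)|move=> _ [n _ <-]].
exists f; split; last first.
  move=> S; apply/andP; split; last exact: le_f.
  by rewrite (le_trans _ (ge_f S 0%N))// /u big_ord0.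
move=> S T fST; apply: contrapT => neST.
have [n Pn nmin] : exists2 n, `[< S n >] != `[< T n >] &
    forall m, (m < n)%N -> `[< S m >] = `[< T m >].
  have h : exists n, `[< S n >] != `[< T n >].
    apply: contrapT => /forallNP h; apply: neST; apply/funext => n.
    by have /negP := h n; rewrite negbK => /eqP e; rewrite (propext (asbool_eq_equiv e)).
  exists (ex_minn h); case: ex_minnP => // m Pm mmin k; rewrite ltnNge.
  by apply: contraNeq => /mmin.
wlog [Sn nTn] : S T fST neST Pn nmin / S n /\ ~ T n.
  move=> h; have [Sn|nSn] := pselect (S n); have [Tn|nTn] := pselect (T n).
  - by move: Pn; rewrite !asboolT.
  - exact: (h S T).
  - apply: (h T S) => //; [by move/esym|by rewrite eq_sym|].
    by move=> m mn; rewrite nmin.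
  - by move: Pn; rewrite !asboolF.
have un : u S n = u T n by apply: eq_bigr => k _; rewrite nmin.
have uS : u S n.+1 = u S n + 3^-1 ^+ n.
  by rewrite uE asboolT.
have uT : u T n.+1 = u T n by rewrite uE asboolF// addr0.
have := ge_f S n.+1.
(* The digits of [T] after [n] contribute at most half of 3^-n, the term that [S] has and [T]
   lacks. *)
have : f T <= u T n + 3^-1 ^+ n / 2.
  apply: le_f => m; have [mn|/ltnW nm] := leqP m n.+1.
    rewrite (le_trans (incr T _ _ mn))// uT.
    by have := @exprn_ge0 R n 3^-1 ltac:(lra); lra.
  have := tail T _ _ nm; rewrite uT exprS.
  by have := @exprn_ge0 R m 3^-1 ltac:(lra); lra.
by have := @exprn_gt0 R n 3^-1 ltac:(lra); lra.
Qed.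

End real_coding.

(** * Bernstein sets *)

Section fat_closed_sets.
Variable R : realType.
Local Notation mu := (@lebesgue_measure R).

(** Positive measure takes the place of uncountability in the usual Bernstein construction: it
    yields continuum many points by continuity of the measure and is what outer regularity tests. *)
Definition fat_closed (K : set R) : Prop :=
  [/\ closed K, K `<=` `[0, 1] & (0 < mu K)%E].

Let mclosed (K : set R) : closed K -> measurable (K : set (measurableTypeR R)).
Proof. by move=> cK; exact: closed_measurable. Qed.

(* [t |-> mu (K `&` [0, t])] is continuous, and each of its values in
   ]0, mu K[ is attained at a point of [K]. *)
Lemma fat_closed_large (K : set R) : fat_closed K -> embeds (set nat) K.
Proof.
move=> [cK K01 K0].
pose cut t : set R := K `&` `[0, t].
have mcut t : measurable (cut t : set (measurableTypeR R)).
  by apply: measurableI; [exact: mclosed|exact: measurable_itv].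
have cutS s t : s <= t -> cut s `<=` cut t.
  move=> st x [Kx]; rewrite /= in_itv /= => /andP[x0 xs]; split => //=.
  by rewrite in_itv /= x0 (le_trans xs).
have finK : mu K \is a fin_num.
  rewrite ge0_fin_numE ?measure_ge0//.
  have h : (mu K <= mu `[0%R, 1%R])%E.
    by apply: le_measure => //; rewrite inE; [exact: mclosed|exact: measurable_itv].
  by rewrite (le_lt_trans h)// lebesgue_measure_itv/= lte01 oppr0 adde0 ltry.
have fincut t : mu (cut t) \is a fin_num.
  rewrite ge0_fin_numE ?measure_ge0//.
  have h : (mu (cut t) <= mu K)%E.
    by apply: le_measure; rewrite ?inE; [exact: mcut|exact: mclosed|exact: subIsetl].
  by rewrite (le_lt_trans h)// -ge0_fin_numE ?measure_ge0.
pose m t := fine (mu (cut t)).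
have m_homo s t : s <= t -> m s <= m t.
  move=> st; apply: fine_le => //; apply: le_measure; rewrite ?inE; [exact: mcut..|].
  exact: cutS.
have m_lip s t : s <= t -> m t <= m s + (t - s).
  move=> st; rewrite -lee_fin EFinD /m !fineK//.
  have h : (mu (cut t) <= mu (cut s `|` `[s, t]))%E.
    apply: le_measure; rewrite ?inE; [exact: mcut| |].
      by apply: measurableU; [exact: mcut|exact: measurable_itv].
    move=> x [Kx]; rewrite /= in_itv /= => /andP[x0 xt].
    have [xs|sx] := leP x s; first by left; split => //=; rewrite in_itv /= x0.
    by right; rewrite /= in_itv /= (ltW sx).
  apply: (le_trans h).
  have hU : (mu (cut s `|` `[s, t]) <= mu (cut s) + mu `[s, t])%E.
    by apply: measureU2; [exact: mcut|exact: measurable_itv].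
  apply: (le_trans hU); apply: leeD => //; rewrite lebesgue_measure_itv /= lte_fin.
  by case: ltP => _ //; rewrite lee_fin subr_ge0.
have m0 : m 0 <= 0.
  rewrite -lee_fin /m fineK//.
  have h : (mu (cut 0%R) <= mu `[0%R, 0%R])%E.
    by apply: le_measure; rewrite ?inE; [exact: mcut|exact: measurable_itv|exact: subIsetr].
  by rewrite (le_trans h)// lebesgue_measure_itv/= ltxx.
have m1 : m 1 = fine (mu K).
  rewrite /m; congr (fine (mu _)); apply/seteqP; split => [x []//|x Kx].
  by split => //; exact: K01.
have m1_gt0 : 0 < m 1 by rewrite m1 -lte_fin fineK.
have attain v : 0 < v < m 1 -> exists a, K a /\ m a = v.
  move=> /andP[v0 v1].
  pose E := [set t | 0 <= t <= 1 /\ m t < v].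
  have E0 : E 0 by split; [rewrite lexx ler01|lra].
  have hE : has_sup E by split; [exists 0|exists 1 => t [/andP[]]].
  have leE t : E t -> t <= sup E by move=> Et; apply: ub_le_sup => //; case: hE.
  have supE1 : sup E <= 1 by apply: ge_sup; [exists 0|move=> t [/andP[]]].
  have adh e : 0 < e -> exists2 t, E t & sup E - e < t by move=> /sup_adherent; exact.
  have mle : m (sup E) <= v.
    apply/ler_addgt0Pr => e e0; have [t Et te] := adh _ e0.
    by have := m_lip _ _ (leE _ Et); case: Et => _ mt; lra.
  have mge : v <= m (sup E).
    rewrite leNgt; apply/negP => mlt.
    (* Moving right by half of the deficit would stay inside [E], unless it passes 1, and then
       [m 1 < v]. *)
    have [d1|d1] := leP (sup E + (v - m (sup E)) / 2) 1.
      have : E (sup E + (v - m (sup E)) / 2).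
        split; first by have := leE _ E0; move=> ?; apply/andP; split; lra.
        by have := @m_lip (sup E) (sup E + (v - m (sup E)) / 2) ltac:(lra); lra.
      by move=> /leE; lra.
    by have := m_lip _ _ supE1; lra.
  exists (sup E); split; last by apply/eqP; rewrite eq_le mle mge.
  (* Off [K] the function [m] is locally constant, so it would already reach [v] at some point of
     [E]. *)
  apply: contrapT => nK.
  have oK : open (~` K) by exact: closed_openC.
  have /nbhs_ballP[e /= e0 eK] : nbhs (sup E) (~` K) by exact: open_nbhs_nbhs.
  have [t Et te] := adh _ e0.
  suff : m (sup E) <= m t by case: Et => _; lra.
  apply: fine_le => //; apply: le_measure; rewrite ?inE; [exact: mcut..|].
  move=> x [Kx]; rewrite /= in_itv /= => /andP[x0 xs]; split => //=.
  rewrite in_itv /= x0 /= leNgt; apply/negP => tx; apply: (eK x) Kx.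
  by rewrite /ball /= ger0_norm; lra.
have [f [fi f32]] := embeds_set_nat_real R.
(* As 0 <= f S <= 3/2, the factor (1 + f S) / 3 lies between 1/3 and 5/6, so the value is
   attained. *)
have /choice[c cP] : forall S, exists a, K a /\ m a = m 1 * (1 + f S) / 3.
  by move=> S; apply: attain; have := f32 S => /andP[? ?]; apply/andP; split; nra.
exists (fun S => exist _ (c S) (mem_set (cP S).1)) => S T [] cST.
have := (cP S).2; rewrite cST (cP T).2 => E.
by apply/fi/esym; nra.
Qed.

(** Cover the part of [A] in the unit interval by an open [U] of nearly the same measure. The rest
    of the interval is closed and misses [A], hence is null, so [U] has measure at least 1. *)
Lemma fat_closed_meet_outer (A : set R) :
  (forall K, fat_closed K -> K `&` A !=set0) ->
  (1 <= ((wlength (R:=R) idfun)^*%mu (`[0%R, 1%R] `&` A)))%E.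
Proof.
move=> fatA; apply/lee_addgt0Pr => e e0.
have [U [oU AU Ue]] := outer_measure_open_le (`[0, 1] `&` A) e0.
apply: le_trans Ue.
have mU : measurable (U : set (measurableTypeR R)) by exact: open_measurable.
pose K := `[0%R, 1%R] `&` ~` U.
have cK : closed K by apply: closedI; [exact: itv_closed|exact: open_closedC].
have K0 : mu K = 0%E.
  apply/eqP; rewrite eq_le measure_ge0 andbT leNgt; apply/negP => K0.
  have [x [[x01 nUx] Ax]] : K `&` A !=set0.
    by apply: fatA; split => //; exact: subIsetl.
  by apply: nUx; apply: AU.
have <- : mu `[0%R, 1%R] = 1%E.
  by rewrite lebesgue_measure_itv/= lte01 oppr0 adde0.
have h : (mu `[0%R, 1%R] <= mu (U `|` K))%E.
  apply: le_measure; rewrite ?inE; [exact: measurable_itv| |].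
    by apply: measurableU; [exact: mU|exact: mclosed].
  by move=> x x01; have [Ux|nUx] := pselect (U x); [left|right].
have hU : (mu (U `|` K) <= mu U + mu K)%E.
  by apply: measureU2; [exact: mU|exact: mclosed].
by rewrite (le_trans h)// (le_trans hU)// K0 adde0.
Qed.

(** Measurability in [LebR] is the Caratheodory splitting identity; tested on the unit interval it
    would give 1 >= 1 + 1. *)
Lemma not_measurable_meet_fat_closed (S : set (LebR R)) :
  (forall K : set R, fat_closed K -> K `&` S !=set0) ->
  (forall K : set R, fat_closed K -> K `&` ~` S !=set0) -> ~ measurable S.
Proof.
move=> /fat_closed_meet_outer h1 /fat_closed_meet_outer h2 mS.
have E : (mu `[0%R, 1%R] = (wlength (R:=R) idfun)^*%mu (`[0%R, 1%R] `&` S) +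
    (wlength (R:=R) idfun)^*%mu (`[0%R, 1%R] `&` ~` S))%E := mS _.
have := leeD h1 h2; rewrite -E lebesgue_measure_itv /= lte01 oppr0 adde0.
by rewrite -EFinD lee_fin; lra.
Qed.

End fat_closed_sets.

Lemma fat_closed_unit_itv (R : realType) : fat_closed (`[0, 1] : set R).
Proof.
split => //; first exact: itv_closed.
by rewrite lebesgue_measure_itv/= lte01 oppr0 adde0.
Qed.

(** There are at most continuum many pairs [(K, d)]. Distinct representatives give each its own
    point of [K], to be labelled [d]; the remaining points get the dummy label [d0]. *)
Lemma bernstein_partition (R : realType) (D : Type) : inhabited D ->
  embeds D (set nat) ->
  exists delta : R -> D, forall d K, fat_closed K -> exists x, K x /\ delta x = d.
Proof.
move=> [d0] Dnat; pose I := ({K : set R | fat_closed K} * D)%type.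
have Inat : embeds I (set nat).
  apply: embeds_prod_set_nat Dnat.
  apply: embeds_trans (embeds_closed_set_nat R).
  have closedF (K : {K : set R | fat_closed K}) : closed (sval K).
    by case: K => K [].
  by exists (fun K => exist _ (sval K) (closedF K)) => K L [] /sval_inj.
have [|psi [psi_inj psiK]] := @distinct_representatives I R (fun i => sval i.1).
  by move=> i; apply: embeds_trans Inat (fat_closed_large (svalP i.1)).
have /choice[delta deltaP] : forall x, exists d, forall i, psi i = x -> i.2 = d.
  move=> x; have [[i <-]|h] := pselect (exists i, psi i = x).
    by exists i.2 => j /psi_inj ->.
  by exists d0 => i ix; exfalso; apply: h; exists i.
exists delta => d K fK; exists (psi (exist _ K fK, d)); split.
  exact: (psiK (exist _ K fK, d)).
by rewrite -(deltaP _ _ erefl).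
Qed.

(** The zero set contains the fibre over [d0] and misses the fibre over [d1], and both fibres meet
    every fat closed set. *)
Lemma not_measurable_separating (R : realType) (D : Type) (delta : R -> D)
    (u : D -> R) (d0 d1 : D) :
  (forall d K, fat_closed K -> exists x, K x /\ delta x = d) ->
  u d0 = 0 -> u d1 <> 0 -> ~ lebesgue_measurable_fun (u \o delta).
Proof.
move=> deltaP u0 u1 mu.
apply: (@not_measurable_meet_fat_closed R ((u \o delta) @^-1` [set 0])).
- by move=> K /(deltaP d0)[x [Kx xd]]; exists x; split => //=; rewrite xd.
- by move=> K /(deltaP d1)[x [Kx xd]]; exists x; split => //=; rewrite xd.
- have := mu measurableT [set 0] (measurable_set1 _).
  by rewrite setTI.
Qed.

(** * An independent family of functions *)

(* The Fichtenholz-Kantorovich-Hausdorff independent family: the index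
   [(N, s, v)] reads off the trace of a set on [s 0, ..., s N.-1] and applies
   the arbitrary function [v] to it. *)
Definition trace_index (R : realType) : Type := nat * (nat -> R) * (seq bool -> R).

Definition trace_fun (R : realType) (A : set R) (d : trace_index R) : R :=
  d.2 [seq `[< A (d.1.2 k) >] | k <- iota 0 d.1.1].

Lemma embeds_trace_index (R : realType) : embeds (trace_index R) (set nat).
Proof.
have Rnat := embeds_real_set_nat R.
apply: embeds_prod_set_nat; last exact: embeds_fun_set_nat.
by apply: embeds_prod_set_nat; [exact: embeds_nat_set_nat|exact: embeds_fun_set_nat].
Qed.

Lemma trace_fun_independent (R : realType) n (A : 'I_n -> set R) (w : 'I_n -> R) :
  injective A -> exists d, forall i, trace_fun (A i) d = w i.
Proof.
move=> Ainj.
(* [pt] picks a real at which two of the sets differ; the implication lets any real serve a diagonal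
   pair. *)
have /choice[pt ptP] : forall p : 'I_n * 'I_n, exists x : R,
    (A p.1 x <-> A p.2 x) -> p.1 = p.2.
  move=> p; apply: contrapT => /forallNP h; apply: (h 0) => _.
  apply: Ainj; apply/funext => x; apply/propext; apply: contrapT => nx.
  by apply: (h x) => /nx.
pose s k := if choice.unpickle k is Some p then pt p else 0.
(* One more than the largest code, so that the trace reads every separating point. *)
pose N := (\max_(p : 'I_n * 'I_n) choice.pickle p).+1.
pose mask i := [seq `[< A i (s k) >] | k <- iota 0 N].
have mask_inj : injective mask.
  move=> i j /eq_in_map /(_ (choice.pickle (i, j))).
  rewrite mem_iota /= add0n ltnS (leq_bigmax (i, j)) => /(_ isT).
  by rewrite /s choice.pickleK => e; exact: (ptP (i, j) (asbool_eq_equiv e)).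
have /choice[v vP] : forall b, exists y, forall i, mask i = b -> y = w i.
  move=> b; have [[i <-]|h] := pselect (exists i, mask i = b).
    by exists (w i) => j /mask_inj ->.
  by exists 0 => i ib; exfalso; apply: h; exists i.
by exists (N, s, v) => i; exact: vP.
Qed.

(** * Evaluation of polynomials in several variables *)

Lemma mpoly_nonroot (R : numDomainType) n (p : {mpoly R[n]}) :
  p != 0 -> exists w : 'I_n -> R, meval w p != 0.
Proof.
(* Regard [p] as univariate in its last variable; by induction some [w] keeps the leading
   coefficient nonzero, and then a non-root is chosen for the last variable. *)
elim: n p => [|n IH] p p0.
  exists (fun=> 0); apply: contraNneq p0 => pw; apply/eqP.
  have m0 (m' : 'X_{1..0}) : m' = 0%MM by apply/mnmP => -[].
  have pC : p = (p@_0%MM)%:MP.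
    by apply/mpolyP => m'; rewrite mcoeffC (m0 m') eqxx mulr1.
  by move: pw; rewrite pC mevalC => ->; rewrite mpolyC0.
have widenE i : widen_ord (leqnSn n) i = lift ord_max i.
  exact/val_inj/esym/lift_max.
have mu0 : muni p != 0.
  (* A monomial [m] of [p] survives in the coefficient of degree [m ord_max]. *)
  have := p0; rewrite -msupp_eq0; case E: (msupp p) => [|m s] // _.
  have mp : m \in msupp p by rewrite E mem_head.
  apply/eqP => /(congr1 (fun q : {poly {mpoly R[n]}} =>
    (q`_(m ord_max))@_[multinom (m (widen_ord (leqnSn n) i)) | i < n])).
  rewrite muniE coef_sum raddf_sum /= coef0 mcoeff0.
  rewrite (bigD1_seq m) ?msupp_uniq //= big1 ?addr0.
    rewrite coefZ coefXn eqxx mulr1 mcoeffZ mcoeffX eqxx mulr1 => /eqP.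
    by rewrite mcoeff_eq0 mp.
  move=> m' m'm; rewrite coefZ coefXn; case: eqP => [e|_]; last by rewrite mulr0 mcoeff0.
  rewrite mulr1 mcoeffZ mcoeffX; case: eqP => [e'|_]; last by rewrite mulr0.
  case/eqP: m'm; apply/mnmP => i.
  have [j ->|->] := @unliftP _ ord_max i; last by [].
  by have := congr1 (fun q : 'X_{1..n} => q j) e'; rewrite !mnmE widenE.
have [w wl] : exists w : 'I_n -> R, meval w (lead_coef (muni p)) != 0.
  by apply: IH; rewrite lead_coef_eq0.
pose q := map_poly (meval w) (muni p).
have q0 : q != 0.
  apply: contraNneq wl => /(congr1 (fun q : {poly R} => q`_(size (muni p)).-1)).
  by rewrite coef0 coef_map /= lead_coefE => ->.
have [t qt] : exists t : R, ~~ root q t.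
  apply: contrapT => /forallNP h.
  (* The naturals below [size q] are distinct and too many to be all roots. *)
  have := @max_poly_roots _ q [seq i%:R | i <- iota 0 (size q)] q0.
  rewrite size_map size_iota ltnn => h'; suff : false by [].
  apply: h'; first by apply/allP => t _; have /negP := h t; rewrite negbK.
  by rewrite map_inj_uniq ?iota_uniq// => i j /eqP; rewrite eqr_nat => /eqP.
pose w' i := if unlift ord_max i is Some j then w j else t.
exists w'; move: qt; rewrite /root; congr (_ != 0).
rewrite /q muniE raddf_sum /= horner_sum mevalE.
apply: eq_bigr => m _.
rewrite map_polyZ /= map_polyXn hornerZ hornerXn /= mevalZ mevalX.
rewrite big_ord_recr /= /w' unlift_none mulrA; congr (_ * _ * _).
apply: eq_bigr => i _; rewrite mnmE.
by rewrite widenE liftK.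
Qed.

(** Needed twice: where a cut net is zero, and at the index where all generators vanish. *)
Lemma meval_cst0 n (S : nzRingType) (p : {mpoly S[n]}) :
  meval (fun=> 0) p = mcoeff 0%MM p.
Proof.
rewrite mevalE {3}(mpolyE p) raddf_sum; apply: eq_bigr => m _ /=.
rewrite mcoeffZ mcoeffX; congr (_ * _); have [->|m0] := eqVneq m 0%MM.
  by rewrite big1// => i _; rewrite mnm0E expr0.
have [i mi] : exists i, m i != 0%N.
  apply/existsP; apply: contraNT m0 => /existsPn h; apply/eqP/mnmP => i.
  by have := h i; rewrite negbK mnm0E => /eqP.
have -> : \prod_(j < n) (0 : S) ^+ m j = \prod_(j < n) ((m j == 0%N)%:R : S).
  by apply: eq_bigr => j _; rewrite expr0n.
by rewrite -natr_prod (bigD1 i)//= (negbTE mi) mul0n.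
Qed.

(** * Nets over finite sequences of null sets *)

Section null_sets.
Variable R : realType.

Lemma null_set_bigcup_seq (T : eqType) (N : T -> set R) (s : seq T) :
  (forall E, E \in s -> Defs.null_set (N E)) ->
  Defs.null_set [set x | exists2 E, E \in s & N E x].
Proof.
elim: s => [_|E s IH h].
  by apply: negligibleS (negligible_set0 _) => x [].
have sub : [set x | exists2 F, F \in E :: s & N F x] `<=`
    N E `|` [set x | exists2 F, F \in s & N F x].
  by move=> x [F]; rewrite inE => /orP[/eqP ->|Fs]; [left|right; exists F].
apply: (@negligibleS _ (measurableTypeR R) _ _ _ _ sub).
apply: negligibleU; first by apply: h; rewrite mem_head.
by apply: IH => F Fs; apply: h; rewrite inE Fs orbT.
Qed.

Lemma not_null_setT : ~ Defs.null_set [set: R].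
Proof.
move=> nT; have null01 : Defs.null_set (`[0, 1] : set R) by apply: negligibleS nT.
have /eqP : lebesgue_measure (`[0, 1]%classic : set R) = 0%E.
  by apply: (measure_negligible _ null01); exact: measurable_itv.
by rewrite lebesgue_measure_itv/= lte01 oppr0 adde0 onee_eq0.
Qed.

(** By completeness: a preimage or its complement lies in [N], according to whether 0 is in the
    target set. *)
Lemma lebesgue_measurable_fun_null_support (f : R -> R) (N : set R) :
  Defs.null_set N -> (forall x, ~ N x -> f x = 0) -> lebesgue_measurable_fun f.
Proof.
move=> [B [mB B0 NB]] fN.
have sub (S : set R) : S `<=` N -> measurable (S : set (LebR R)).
  move=> SN; apply: negligible_sub_caratheodory; exists B; split => //.
    exact: sub_caratheodory.
  exact: subset_trans NB.
move=> _ Y mY; rewrite setTI; have [Y0|nY0] := pselect (Y 0).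
  rewrite -[X in measurable X]setCK; apply: measurableC; apply: sub => x nYx.
  by apply: contrapT => /fN fx; apply: nYx; rewrite /= fx.
by apply: sub => x Yx; apply: contrapT => /fN fx; apply: nY0; rewrite -fx.
Qed.

Definition null_cover (G : set (set R)) : Prop :=
  (forall E, G E -> Defs.null_set E) /\ \bigcup_(E in G) E = setT.

(** [embeds_minimum] applied to the family of all null covers, inhabited by the cover by singletons;
    the cardinality of [G] is cov(N). *)
Lemma exists_minimum_null_cover : exists G, null_cover G /\
  forall H, null_cover H -> embeds G H.
Proof.
pose X (G : {G | null_cover G}) : Type := set_type (sval G).
have [|G Gmin] := @embeds_minimum _ X.
  have h : null_cover (range (fun x : R => [set x])).
    split; first by move=> _ [x _ <-]; apply/negligibleP => //; exact: lebesgue_measure_set1.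
    by apply/seteqP; split => // x _; exists [set x] => //; exists x.
  by apply: inhabits; exists (range (fun x : R => [set x])).
exists (sval G); split; first exact: svalP.
by move=> H cH; exact: (Gmin (exist _ H cH)).
Qed.

(** Finite unions of null sets are null. Infinity is what gives [seq G] the cardinality of [G]. *)
Lemma null_cover_infinite (G : set (set R)) : null_cover G -> embeds nat G.
Proof.
move=> [Gnull GT].
have : infinite_set G.
  move=> /finite_seqP[s Gs]; apply: not_null_setT.
  apply: negligibleS (@null_set_bigcup_seq _ id s _).
    by move=> x _; have : setT x by []; rewrite -GT Gs => -[E sE Ex]; exists E.
  by move=> E Es; apply: Gnull; rewrite Gs.
move=> /infiniteP /card_le_embeds; apply: embeds_trans.
exact: (embeds_setT nat).2.
Qed.

End null_sets.

Section inclusion_nets.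
Variables (R : realType) (G : set (set R)).
Hypothesis G_cover : null_cover G.

(** Sequences stand for finite subsets because [embeds_seq] counts them; order and repetition being
    ignored, this is only a preorder. *)
Definition incl_seq (s t : seq G) : Prop := {subset s <= t}.

Definition seq_union (s : seq G) : set R := [set x | exists2 E, E \in s & val E x].

Definition cut_net (g : R -> R) (s : seq G) (x : R) : R :=
  if `[< seq_union s x >] then g x else 0.

Lemma null_seq_union s : Defs.null_set (seq_union s).
Proof.
by apply: null_set_bigcup_seq => E _; apply: G_cover.1; exact: set_mem (valP E).
Qed.

Lemma seq_union_cofinal x : exists s0, forall s, incl_seq s0 s -> seq_union s x.
Proof.
have [E GE Ex] : (\bigcup_(E in G) E) x by rewrite G_cover.2.
exists [:: exist _ E (mem_set GE)] => s /(_ _ (mem_head _ _)) Es.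
by exists (exist _ E (mem_set GE)).
Qed.

Lemma directed_incl_seq : directed_set incl_seq.
Proof.
split; [exact: (inhabits [::])|split; [by move=> s E|split]].
  by move=> s t u st tu E /st/tu.
move=> s t; exists (s ++ t).
by split=> E Es; rewrite mem_cat Es ?orbT.
Qed.

Lemma not_cardinal_incl_seq : ~ is_cardinal_order incl_seq.
Proof.
have [e e_inj] := null_cover_infinite G_cover.
move=> [_ [total _]].
(* Distinct one-term sequences are incomparable, so totality fails. *)
have ne m n : m != n -> ~ incl_seq [:: e m] [:: e n].
  by move=> mn /(_ (e m) (mem_head _ _)); rewrite inE => /eqP/e_inj/eqP; apply/negP.
by have [/ne|/ne] := total [:: e 0%N] [:: e 1%N]; apply.
Qed.

Lemma peval_cut_net n (P : {mpoly R[n]}) (g : 'I_n -> R -> R) s x :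
  mcoeff 0%MM P = 0 ->
  peval P (fun i => cut_net (g i)) s x =
    cut_net (fun y => meval (fun i => g i y) P) s x.
Proof. by move=> P0; rewrite /peval /cut_net; case: asboolP => // _; rewrite meval_cst0. Qed.

Lemma AN_cut_net g : ~ lebesgue_measurable_fun g -> AN incl_seq (cut_net g).
Proof.
move=> ng; split=> [s|].
  apply: (lebesgue_measurable_fun_null_support (null_seq_union s)) => x nx.
  by rewrite /cut_net asboolF.
(* Convergence holds at every point, the net being eventually equal to [g x]. *)
exists g; split => //; exists set0; split; first exact: negligible_set0.
move=> x _ U Ug; have [s0 s0P] := seq_union_cofinal x.
by exists s0 => s /s0P sx; rewrite /cut_net asboolT//; exact: nbhs_singleton.
Qed.

Lemma card_is_covN_seq (Gmin : forall H : set (set R), null_cover H -> embeds G H) :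
  card_is_covN R (seq G).
Proof.
have [e e_inj] := null_cover_infinite G_cover.
have [T1 T2] := embeds_setT (seq G).
have GT : embeds (seq G) G := embeds_seq e_inj.
have [G1 G2] := G_cover; split.
  exists G; split => //; split => //; rewrite card_eq_le; apply/andP; split.
    apply/card_le_embeds; apply: embeds_trans T2.
    by exists (fun x => [:: x]) => x y [].
  by apply/card_le_embeds; apply: embeds_trans T1 GT.
move=> H H1 H2; apply/card_le_embeds.
by apply: embeds_trans T1 (embeds_trans GT (Gmin H _)).
Qed.

End inclusion_nets.

(* 2^c is the cardinality of set R (the power set of R). *)
Theorem mainTheorem6 (R : realType) :
  exists (A : Type) (le : A -> A -> Prop),
    directed_set le /\ ~ is_cardinal_order le /\ card_is_covN R A /\
    strongly_algebrable (fun F : A -> R -> R => AN le F) (set R).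
Proof.
have [G [Gcov Gmin]] := exists_minimum_null_cover R.
exists (seq G), (@incl_seq R G); split; first exact: directed_incl_seq.
split; first exact: not_cardinal_incl_seq.
split; first exact: card_is_covN_seq.
(* The third component is zero, so every [trace_fun A] vanishes at [d0]. *)
pose d0 : trace_index R := (0%N, fun=> 0, fun=> 0).
have [delta deltaP] :=
  @bernstein_partition R _ (inhabits d0) (embeds_trace_index R).
(* The unit interval is itself fat, so every label occurs. *)
have delta_onto d : exists x, delta x = d.
  by have [x [_ xd]] := deltaP d _ (fat_closed_unit_itv R); exists x.
pose g (A : set R) : R -> R := trace_fun A \o delta.
pose F (A : set R) := @cut_net R G (g A).
(* A single index and point realize any prescribed values of finitely many generators, which gives
   both injectivity of [F] and algebraic independence. *)
have F_attains n (A : 'I_n -> set R) (w : 'I_n -> R) : injective A ->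
    exists s x, forall i, F (A i) s x = w i.
  move=> Ainj; have [d dP] := trace_fun_independent w Ainj; have [x xd] := delta_onto d.
  have [s sP] := seq_union_cofinal Gcov x; exists s, x => i.
  by rewrite /F /cut_net asboolT ?/g /= ?xd//; exact: sP.
have F_inj : injective F.
  move=> A B FAB; apply: contrapT => AB.
  have [|s [x sx]] := F_attains 2 (fun i => if i == ord0 then A else B)
      (fun i => if i == ord0 then 0 else 1).
    move=> [[|[|//]] ?] [[|[|//]] ?]; rewrite -!val_eqE /= => E; try exact: val_inj.
    by case: AB; rewrite E.
  have := sx ord0; have := sx ord_max; rewrite /= FAB => -> /eqP.
  by rewrite oner_eq0.
exists (range F); split; last split.
- by apply: inj_card_eq => A B _ _; exact: F_inj.
- move=> n f P f_inj fX P0 _.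
  have /choice[A AP] : forall i, exists A, F A = f i.
    by move=> i; have [A _ <-] := fX i; exists A.
  have A_inj : injective A by move=> i j Aij; apply: f_inj; rewrite -!AP Aij.
  have [w Pw] := mpoly_nonroot P0; have [s [x sx]] := F_attains _ _ w A_inj.
  move=> /(congr1 (fun h => h s x)) /eqP; rewrite /peval; apply/negP.
  by move: Pw; congr (meval _ _ != _); apply/funext => i; rewrite -AP sx.
- move=> n f P fX P0 Pf.
  have /choice[A AP] : forall i, exists A, F A = f i.
    by move=> i; have [A _ <-] := fX i; exists A.
  pose u d := meval (fun i => trace_fun (A i) d) P.
  have PE : peval P f = cut_net (u \o delta).
    have -> : f = fun i => cut_net (g (A i)) by apply/funext => i; rewrite -AP.
    by apply/funext => s; apply/funext => x; rewrite peval_cut_net.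
  rewrite PE; apply: AN_cut_net => //.
  (* If [u] were identically zero, the combination would be the zero net. *)
  have [d1 ud1] : exists d, u d <> 0.
    apply: contrapT => /forallNP u0; apply: Pf; rewrite PE.
    apply/funext => s; apply/funext => x; rewrite /cut_net; case: asboolP => // _.
    by apply: contrapT => /u0.
  apply: (not_measurable_separating deltaP (d0 := d0) _ ud1).
  by rewrite -P0 -meval_cst0.
Qed.
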